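(* Let $G$ be a finite simple connected graph with $n=|V(G)|\geq 5$. Suppose there is a vertex $v\in V(G)$ whose neighbourhood $N_G(v)$ is covered by at most two cliques. If the distance-$2$ graph $G_2$ is triangle-free, then $G_2$ has at most $(n-1)^2/4+1$ edges.
   Context: For a graph $G$, the distance-$2$ graph $G_2$ has vertex set $V(G)$, and $\{x,y\}$ is an edge of $G_2$ if and only if $d_G(x,y)=2$, where $d_G$ is the shortest-path distance in $G$. A set of vertices is covered by at most two cliques if it is the union of at most two sets each inducing a complete subgraph of $G$. *)

(* Defs.v *)
(* Built on the Mathematical Components library. A simple graph is a symmetric
   irreflexive relation [e : rel T] on a [finType]. *)
From mathcomp Require Import all_boot.

Set Implicit Arguments.
Unset Strict Implicit.
Unset Printing Implicit Defensive.

Section Graphs.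
Variable T : finType.
Implicit Types (e : rel T) (x y z v : T) (A B : {set T}).

Definition simple_graph e : Prop := symmetric e /\ irreflexive e.

Definition connected_graph e : Prop := forall x y, connect e x y.

Definition has_walk e (k : nat) x y : bool :=
  [exists p : k.-tuple T, path e x p && (last x p == y)].

(* [None] stands for infinite distance. Searching the lengths below [#|T|] is
   enough, since a shortest walk has no repeated vertex; see [gdistP]. *)
Definition gdist e x y : option nat :=
  ohead [seq k <- iota 0 #|T| | has_walk e k x y].

Definition dist2_graph e : rel T := fun x y => gdist e x y == Some 2.

Definition neighbourhood e v : {set T} := [set x | e v x].

Definition clique e A : Prop := {in A &, forall x y, x != y -> e x y}.

(* Either clique may be empty, or equal to the other: this is what makes it
   "at most" two. *)
Definition covered_by_two_cliques e A : Prop :=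
  exists B C : {set T}, [/\ clique e B, clique e C & A = B :|: C].

Definition triangle_free e : Prop :=
  forall x y z, ~~ [&& e x y, e y z & e x z].

Definition edge_set e : {set {set T}} :=
  [set [set p.1; p.2] | p in [pred p : T * T | e p.1 p.2]].

Lemma has_walkP e k x y :
  reflect (exists p : seq T, [/\ size p = k, path e x p & last x p = y])
          (has_walk e k x y).
Proof.
apply: (iffP existsP) => [[p /andP[ep /eqP lp]]|[p [sp ep lp]]].
  by exists p; rewrite size_tuple.
by move/eqP: sp => sp; exists (Tuple sp); rewrite /= ep lp eqxx.
Qed.

Lemma has_walk_short e k x y :
  has_walk e k x y -> exists2 j, j < #|T| & (j <= k) && has_walk e j x y.
Proof.
case/has_walkP=> p [sp ep lp].
case/shortenP: ep lp => p' ep' up' sub_p' lp'.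
have lt_p' : size p' < #|T|.
  by move/card_uniqP: up' => /= <-; apply: max_card.
have le_p' : size p' <= k.
  by rewrite -sp uniq_leq_size //; case/andP: up'.
exists (size p') => //; rewrite le_p' /=.
by apply/has_walkP; exists p'.
Qed.

Lemma gdistP e x y d :
  gdist e x y = Some d <->
  has_walk e d x y /\ (forall k, has_walk e k x y -> d <= k).
Proof.
rewrite /gdist; set s := filter _ _.
have s_sorted : sorted ltn s.
  by apply: sorted_filter; [apply: ltn_trans | apply: iota_ltn_sorted].
have mem_s k : (k \in s) = has_walk e k x y && (k < #|T|).
  by rewrite mem_filter mem_iota.
case: s s_sorted mem_s => [|h s] s_sorted mem_s /=.
  split=> // -[/has_walk_short [j lt_j /andP[_ wj]] _].
  by have := mem_s j; rewrite wj lt_j.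
have /andP[wh _] : has_walk e h x y && (h < #|T|).
  by rewrite -mem_s mem_head.
have min_h k : has_walk e k x y -> h <= k.
  case/has_walk_short=> j lt_j /andP[le_jk wj]; apply: leq_trans le_jk.
  have := mem_s j; rewrite wj lt_j inE => /orP[/eqP -> // | js].
  by move: (order_path_min ltn_trans s_sorted) => /allP /(_ j js) /ltnW.
split=> [[<-] // | [wd min_d]]; congr Some.
by apply/eqP; rewrite eqn_leq min_h // min_d.
Qed.

End Graphs.

(* Main.v *)
(* Write [d] for the degree in the distance-2 graph [H]. If [x] and [y] are
   adjacent in [H], their neighbourhoods in [H] are disjoint and both miss the
   middle vertex of a path of length 2 from [x] to [y], so [d x + d y <= n - 1].
   If [d x + d y <= n - 2] for all edges, summing over the edges and applying
   Cauchy-Schwarz gives [|E(H)| <= n (n - 2) / 4]. Otherwise some edge [xy] has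
   [d x + d y = n - 1], and all vertices but one, [w], are split into the
   independent sets [A = N(y)] and [B = N(x)]. If [w] has [a >= 1] neighbours in
   [A] and [b >= 1] in [B], then
   [|E(H)| <= |A||B| - a b + a + b <= |A||B| + 1]. If [w] has no neighbour in
   [A], say, then [B] is a vertex cover whose vertices have degree at most
   [n - 1 - d x = |A|], so [|E(H)| <= |A||B|]. *)
Require Import Defs.
From mathcomp Require Import all_boot all_order all_algebra zify lra.

Import Order.TTheory GRing.Theory Num.Theory.

(** * Degree sums and edge counts in an abstract graph *)

Section TriangleFree.
Variables (T : finType) (h : rel T).
Hypotheses (h_sym : symmetric h) (h_irr : irreflexive h).

Let N := neighbourhood h.
Let d x := #|N x|.

Lemma mem_neighbourhood x y : (y \in N x) = h x y.
Proof. by rewrite inE. Qed.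

Lemma card_pairs : #|[pred p : T * T | h p.1 p.2]| = \sum_x d x.
Proof.
rewrite -sum1_card (eq_bigl (fun p : T * T => true && h p.1 p.2)) //.
rewrite -(pair_big_dep xpredT (fun x y => h x y) (fun _ _ => 1)) /=.
by apply: eq_bigr => x _; rewrite /d -sum1_card; apply: eq_bigl => y; rewrite inE.
Qed.

(** The fibre over an edge contains both orderings of its ends, which differ by irreflexivity. *)
Lemma double_edges_le_degree_sum : 2 * #|edge_set h| <= \sum_x d x.
Proof.
rewrite -card_pairs -[leqRHS]sum1_card.
rewrite (partition_big_imset (fun p : T * T => [set p.1; p.2])) /=.
rewrite mulnC -sum_nat_const; apply: leq_sum => E /imsetP[[x y] /= hxy ->].
rewrite inE /= in hxy.
have nxy : x != y by apply: contraTneq hxy => ->; rewrite h_irr.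
rewrite (bigD1 (x, y)) /=; last by rewrite inE hxy eqxx.
rewrite (bigD1 (y, x)) //=.
by rewrite inE /= h_sym hxy setUC eqxx /= xpair_eqE negb_and eq_sym nxy.
Qed.

(** A vertex outside [S] has all its neighbours in [S], so the degrees outside [S] count edges that
    the degrees inside [S] count too. *)
Lemma degree_sum_cover (S : {set T}) :
  (forall x y, h x y -> (x \in S) || (y \in S)) ->
  \sum_x d x <= 2 * \sum_(x in S) d x.
Proof.
move=> cover; rewrite (bigID (mem S)) /= mul2n -addnn leq_add2l.
have dE x : d x = \sum_y h x y.
  by rewrite /d -sum1_card big_mkcond; apply: eq_bigr => y _; rewrite inE; case: h.
under eq_bigr do rewrite dE.
under [leqRHS]eq_bigr do rewrite dE.
rewrite exchange_big /= [leqRHS]big_mkcond /=; apply: leq_sum => y _.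
have [yS|yS] := boolP (y \in S).
  rewrite [leqLHS]big_mkcond /=; apply: leq_sum => x _.
  by rewrite h_sym; case: ifP.
rewrite big1 // => x xS; case hxy: (h x y) => //.
by have := cover _ _ hxy; rewrite (negPf xS) (negPf yS).
Qed.

Lemma degree_sum_sqr : (\sum_x d x) ^ 2 <= #|T| * \sum_x d x ^ 2.
Proof.
(* Doubling turns Cauchy-Schwarz into a termwise comparison of [2 * (d x * d y)] with
   [d x ^ 2 + d y ^ 2]. *)
rewrite -(leq_pmul2l (isT : 0 < 2)) -mulnn big_distrlr /= big_distrr /=.
have -> : 2 * (#|T| * \sum_x d x ^ 2) = \sum_x \sum_y (d x ^ 2 + d y ^ 2).
  under [RHS]eq_bigr do rewrite big_split /= sum_nat_const.
  by rewrite big_split /= sum_nat_const -big_distrr /= addnn mul2n.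
apply: leq_sum => x _; rewrite big_distrr /=.
by apply: leq_sum => y _; apply: nat_Cauchy.
Qed.

Lemma sum_edge_degrees :
  \sum_x \sum_(y in N x) (d x + d y) = 2 * \sum_x d x ^ 2.
Proof.
under eq_bigr do rewrite big_split /= sum_nat_const mulnn.
rewrite big_split /= mul2n -addnn; congr (_ + _).
under eq_bigr do rewrite big_mkcond /=.
rewrite exchange_big /=; apply: eq_bigr => y _.
rewrite -mulnn -sum_nat_const [RHS]big_mkcond /=.
by apply: eq_bigr => x _; rewrite !mem_neighbourhood h_sym.
Qed.

(** With [D] the degree sum, [sum_edge_degrees] and [degree_sum_sqr] give
    [2 * D ^ 2 <= #|T| * D * k]; then [D] cancels unless it is 0. *)
Lemma degree_sum_bound k :
  (forall x y, h x y -> d x + d y <= k) -> 2 * \sum_x d x <= #|T| * k.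
Proof.
move=> dk; set D := \sum_x d x.
have le_sqr : 2 * \sum_x d x ^ 2 <= D * k.
  rewrite -sum_edge_degrees big_distrl /=; apply: leq_sum => x _.
  rewrite -sum_nat_const; apply: leq_sum => y.
  by rewrite mem_neighbourhood; apply: dk.
have := degree_sum_sqr; rewrite -/D => CS.
have [->//|D0] := posnP D.
rewrite -(leq_pmul2l D0); nia.
Qed.

Hypothesis h_free : triangle_free h.

Lemma neighbourhood_indep x y z : h x y -> h x z -> ~~ h y z.
Proof. by move=> hxy hxz; apply/negP => hyz; have := h_free x y z; rewrite hxy hyz hxz. Qed.

Lemma disjoint_neighbourhoods x y : h x y -> N x :&: N y = set0.
Proof.
move=> hxy; apply/setP=> z; rewrite !inE; apply/negP=> /andP[hxz hyz].
by have := neighbourhood_indep x y z hxy hxz; rewrite hyz.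
Qed.

(** * An edge whose two neighbourhoods miss a single vertex [w] *)

Section OneExtraVertex.
Variables (x y w : T).
Hypotheses (hxy : h x y) (Vw : ~: (N x :|: N y) = [set w]).

Lemma edge_outside b c :
  b \in N x -> h b c -> (c \in N y) || (c == w).
Proof.
rewrite mem_neighbourhood => hxb hbc; have := in_set1 c w; rewrite -Vw => <-.
have : c \notin N x.
  by rewrite mem_neighbourhood; apply: contraTN hbc => /(neighbourhood_indep _ _ _ hxb).
by rewrite in_setC in_setU => /negPf ->; rewrite orbN.
Qed.

(** The neighbours of [b] lie in [N y] or equal [w]. If [w] is one of them, [b] gains it but loses
    every neighbour of [w] in [N y], as these would close a triangle. *)
Lemma side_degree b :
  b \in N x -> d b + h w b * #|N w :&: N y| <= d y + h w b.
Proof.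
move=> bx; case hwb: (h w b); last first.
  rewrite mul0n !addn0; apply/subset_leq_card/subsetP => c.
  rewrite mem_neighbourhood => hbc; case/orP: (edge_outside _ _ bx hbc) => // /eqP cw.
  by move: hbc; rewrite cw h_sym hwb.
suff: d b <= #|w |: (N y :\: N w)|.
  have := cardsID (N w) (N y); rewrite setIC cardsU1 /d.
  by case: (_ \notin _) => /=; lia.
apply/subset_leq_card/subsetP => c; rewrite mem_neighbourhood => hbc.
case/orP: (edge_outside _ _ bx hbc) => [cy|/eqP->]; last by rewrite setU11.
rewrite !(in_setU1, in_setD) cy andbT mem_neighbourhood; apply/orP; right.
by apply: contraTN hbc => /(neighbourhood_indep _ _ _ hwb).
Qed.

Lemma side_degree_sum :
  \sum_(b in N x) d b + #|N w :&: N x| * #|N w :&: N y|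
    <= d x * d y + #|N w :&: N x|.
Proof.
have -> : #|N w :&: N x| = \sum_(b in N x) h w b.
  rewrite -sum1_card big_mkcond [RHS]big_mkcond; apply: eq_bigr => b _.
  by rewrite in_setI !mem_neighbourhood; do 2 case: h.
rewrite big_distrl -big_split /= -sum_nat_const -big_split /=.
by apply: leq_sum => b; apply: side_degree.
Qed.

(** Outside [N x] there are only [w] and the independent set [N y], with no edge between them. *)
Lemma side_cover u v :
  N w :&: N y = set0 -> h u v -> (u \in N x) || (v \in N x).
Proof.
move=> wy huv; case: (boolP (u \in N x)) => //= nu; apply: contraT => nv.
have side z : z \notin N x -> h y z \/ z = w.
  move=> nz; have := in_set1 z w; rewrite -Vw in_setC in_setU (negPf nz) /=.
  by rewrite mem_neighbourhood; case: (h y z) => /=; [left|move/esym/eqP; right].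
have nwy z : h w z -> ~~ h y z.
  by move=> hwz; have /setP/(_ z) := wy; rewrite in_setI !mem_neighbourhood hwz in_set0 => /= ->.
case: (side u nu) => [yu|uw]; case: (side v nv) => [yv|vw].
- by have := neighbourhood_indep _ _ _ yu yv; rewrite huv.
- by have := nwy u; rewrite -vw h_sym huv yu => /(_ isT).
- by have := nwy v; rewrite -uw huv yv => /(_ isT).
by move: huv; rewrite uw vw h_irr.
Qed.

End OneExtraVertex.

(** Disjoint neighbourhoods alone give [<=]; [dist2_degrees] provides the strict form. *)
Hypothesis h_missed : forall x y, h x y -> d x + d y < #|T|.

Lemma degree_sum_one_sided x y w :
  d x + d y = #|T|.-1 -> ~: (N x :|: N y) = [set w] ->
  N w :&: N y = set0 -> \sum_z d z <= 2 * (d x * d y).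
Proof.
move=> dxy Vw wy.
apply: leq_trans (degree_sum_cover (N x) (fun u v => side_cover x y w Vw u v wy)) _.
rewrite leq_mul2l /= -sum_nat_const; apply: leq_sum => b.
by rewrite mem_neighbourhood => /h_missed; lia.
Qed.

Lemma degree_sum_extremal x y :
  h x y -> d x + d y = #|T|.-1 -> \sum_z d z <= 2 * (d x * d y) + 2.
Proof.
move=> hxy dxy; have hyx : h y x by rewrite h_sym.
have dI := disjoint_neighbourhoods x y hxy.
have /cards1P[w Vw] : #|~: (N x :|: N y)| == 1.
  have := cardsC (N x :|: N y); have := h_missed x y hxy.
  by rewrite cardsU dI cards0 subn0; move: dxy; rewrite /d; lia.
have Vw' : ~: (N y :|: N x) = [set w] by rewrite setUC.
have [wy|wy] := eqVneq (N w :&: N y) set0.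
  by apply: leq_trans (degree_sum_one_sided x y w dxy Vw wy) _; rewrite leq_addr.
have [wx|wx] := eqVneq (N w :&: N x) set0.
  rewrite addnC in dxy.
  by have := degree_sum_one_sided y x w dxy Vw' wx; rewrite [d y * _]mulnC; lia.
have /andP[wNx wNy] : (w \notin N x) && (w \notin N y).
  by rewrite -negb_or -in_setU -in_setC Vw set11.
have splitV F : \sum_z F z = \sum_(z in N x) F z + \sum_(z in N y) F z + F w :> nat.
  rewrite (bigID (mem (N x :|: N y))) /=; congr (_ + _).
    rewrite (eq_bigl [predU N x & N y]) => [|z]; last by rewrite in_setU.
    by rewrite bigU // -setI_eq0 dI.
  by rewrite -(big_set1 addn w F) -Vw; apply: eq_bigl => z; rewrite !inE.
have dw : d w = #|N w :&: N x| + #|N w :&: N y|.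
  rewrite /d -(cardsID (N x) (N w)); congr (_ + _); apply: eq_card => z.
  rewrite in_setD in_setI; have [->|zw] := eqVneq z w.
    by rewrite (negPf wNy) [w \in N w]mem_neighbourhood h_irr andbF.
  have := in_set1 z w; rewrite (negPf zw) -Vw in_setC in_setU => /negbFE.
  have /setP/(_ z) := dI; rewrite in_setI in_set0.
  by case: (z \in N x); case: (z \in N y) => //=; rewrite ?andbF ?andbT.
have := side_degree_sum x y w hxy Vw; have := side_degree_sum y x w hyx Vw'.
rewrite splitV dw; move: wx wy; rewrite -!card_gt0.
(* With [p] and [q] neighbours of [w] on the two sides, the excess over [2 * (d x * d y)] is at most
   [2 * (p + q - p * q)], and [(p - 1) * (q - 1) >= 0]. *)
nia.
Qed.

Lemma edges_bound : 4 * #|edge_set h| <= #|T|.-1 ^ 2 + 4.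
Proof.
apply: (@leq_trans (2 * \sum_x d x)).
  by rewrite -[4]/(2 * 2) -mulnA leq_mul2l double_edges_le_degree_sum.
have [|none] := boolP [exists p : T * T, h p.1 p.2 && (d p.1 + d p.2 == #|T|.-1)].
  case/existsP=> -[x y] /= /andP[hxy /eqP dxy].
  have := degree_sum_extremal x y hxy dxy.
  have [+ _] := nat_Cauchy (d x) (d y); rewrite -dxy sqrnD; lia.
have /degree_sum_bound : forall x y, h x y -> d x + d y <= #|T| - 2.
  move=> x y hxy; have := h_missed x y hxy; have : d x + d y != #|T|.-1.
    by move/existsPn/(_ (x, y)): none; rewrite /= hxy.
  by move/eqP; lia.
(* Here [n * (n - 2)] stays below [(n - 1) ^ 2]. *)
rewrite -mulnn; nia.
Qed.

End TriangleFree.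

(** * The distance-2 graph meets these assumptions *)

Section Distance2.
Variables (T : finType) (e : rel T).
Hypothesis e_sym : symmetric e.

Lemma dist2_graphP x y :
  reflect [/\ x != y, ~~ e x y & exists2 w, e x w & e w y] (dist2_graph e x y).
Proof.
apply: (iffP eqP) => [/gdistP[/has_walkP[p [sp ep lp]] min2]|[nxy nexy [w exw ewy]]].
  split.
  - apply/eqP => xy; suff /min2 : has_walk e 0 x y by [].
    by apply/has_walkP; exists [::].
  - apply/negP => exy; suff /min2 : has_walk e 1 x y by [].
    by apply/has_walkP; exists [:: y]; rewrite /= exy.
  case: p sp ep lp => [|w [|z []]] //= _ /and3P[exw ewz _] zy.
  by exists w; rewrite // -zy.
apply/gdistP; split=> [|k /has_walkP[p [<- ep lp]]].
  by apply/has_walkP; exists [:: w; y]; rewrite /= exw ewy.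
case: p ep lp => [_ /= xy|z [|//] /= /andP[exz _] zy].
  by rewrite xy eqxx in nxy.
by rewrite -zy exz in nexy.
Qed.

Lemma dist2_sym : symmetric (dist2_graph e).
Proof.
have sub x y : dist2_graph e x y -> dist2_graph e y x.
  case/dist2_graphP=> nxy nexy [w exw ewy]; apply/dist2_graphP.
  by rewrite eq_sym e_sym; split=> //; exists w; rewrite e_sym.
by move=> x y; apply/idP/idP; apply: sub.
Qed.

Lemma dist2_irr : irreflexive (dist2_graph e).
Proof. by move=> x; apply/dist2_graphP => -[]; rewrite eqxx. Qed.

Lemma dist2_degrees x y :
  triangle_free (dist2_graph e) -> dist2_graph e x y ->
  #|neighbourhood (dist2_graph e) x| + #|neighbourhood (dist2_graph e) y| < #|T|.
Proof.
move=> free hxy; case/dist2_graphP: (hxy) => _ _ [w exw ewy].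
set A := neighbourhood _ x; set B := neighbourhood _ y.
have -> : #|A| + #|B| = #|A :|: B|.
  by rewrite cardsU (disjoint_neighbourhoods T _ free x y hxy) cards0 subn0.
rewrite -cardsT; apply/proper_card/properP; split; first exact: subsetT.
(* The middle vertex [w] is adjacent in [e] to both ends, hence at distance 2 from neither. *)
exists w; first exact: in_setT.
rewrite !inE negb_or; apply/andP; split; apply/dist2_graphP => -[_].
  by rewrite exw.
by rewrite e_sym ewy.
Qed.

End Distance2.

Local Open Scope ring_scope.

Theorem theorem3p1 (T : finType) (e : rel T) :
  simple_graph e -> connected_graph e -> (5 <= #|T|)%N ->
  (exists v : T, covered_by_two_cliques e (neighbourhood e v)) ->
  triangle_free (dist2_graph e) ->
  #|edge_set (dist2_graph e)|%:R <= (#|T|%:R - 1) ^+ 2 / 4 + 1 :> rat.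
Proof.
move=> [e_sym _] _ T5 _ free.
have := edges_bound T _ (dist2_sym _ _ e_sym) (dist2_irr _ _) free
          (fun x y => dist2_degrees _ _ e_sym x y free).
(* The truncated predecessor is the true one because [#|T|] is positive. *)
have -> : #|T|%:R - 1 = #|T|.-1%:R :> rat.
  by rewrite -subn1 natrB // (leq_trans _ T5).
rewrite -(ler_nat rat) natrD natrM natrX; lra.
Qed.
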